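(* Let $F$ be a field of positive characteristic $p$ and let $G$ and $H$ be finite $p$-groups. Let $G_{\mathrm{A}}$ be an abelian direct factor of $G$ of maximum order and let $H_{\mathrm{A}}$ be an abelian direct factor of $H$ of maximum order. If $FG \cong FH$ as $F$-algebras, then $F[G/G_{\mathrm{A}}] \cong F[H/H_{\mathrm{A}}]$ as $F$-algebras.
   Context: For a finite group $G$, $FG$ (also written $F[G]$) denotes the group algebra of $G$ over $F$. For a finite $p$-group $G$, $G_{\mathrm{A}}$ denotes an abelian direct factor of $G$ of maximum order, i.e. an abelian subgroup of $G$ that has a complementary direct factor in $G$ and whose order is the largest among all such subgroups; then $G \cong G/G_{\mathrm{A}} \times G_{\mathrm{A}}$, and $G_{\mathrm{A}}$ is uniquely determined up to isomorphism. *)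

(* Defs.v *)
From HB Require Import structures.
From mathcomp Require Import all_boot all_fingroup all_algebra all_solvable.

Set Implicit Arguments.
Unset Strict Implicit.
Unset Printing Implicit Defensive.

Import GRing.Theory.
Local Open Scope ring_scope.

(* The element \sum_x a_x x of the group algebra is encoded by its coefficient
   function x |-> a_x. The alias hides the pointwise ring structure that the
   library puts on {ffun _ -> R}; only its module structure is kept. *)
Definition group_algebra (R : comNzRingType) (gT : finGroupType)
    (G : {group gT}) : Type :=
  {ffun subg_of G -> R^o}.

Section GroupAlgebra.

Variables (R : comNzRingType) (gT : finGroupType) (G : {group gT}).
Local Notation A := (group_algebra R G).
Implicit Types u v w : A.

HB.instance Definition _ := GRing.Lmodule.on A.

Definition galg_one : A := [ffun x => (x == 1%g)%:R].

Definition galg_mul u v : A := [ffun x => \sum_y u y * v (y^-1 * x)%g].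

Fact galg_mulA : associative galg_mul.
Proof.
move=> u v w; apply/ffunP=> x; rewrite !ffunE.
under eq_bigr => y _ do rewrite ffunE mulr_sumr.
under [RHS]eq_bigr => z _ do rewrite ffunE mulr_suml.
rewrite [RHS]exchange_big /=; apply: eq_bigr => y _.
rewrite [RHS](reindex_inj (mulgI y)) /=; apply: eq_bigr => z _.
by rewrite mulrA mulKg invMg mulgA.
Qed.

Fact galg_mul1l : left_id galg_one galg_mul.
Proof.
move=> u; apply/ffunP=> x; rewrite ffunE (bigD1 1%g) //= big1 => [|y ny1].
  by rewrite ffunE eqxx mul1r invg1 mul1g addr0.
by rewrite ffunE (negPf ny1) mul0r.
Qed.

Fact galg_mul1r : right_id galg_one galg_mul.
Proof.
move=> u; apply/ffunP=> x; rewrite ffunE (bigD1 x) //= big1 => [|y nyx].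
  by rewrite ffunE mulVg eqxx mulr1 addr0.
by rewrite ffunE -eq_mulVg1 (negPf nyx) mulr0.
Qed.

Fact galg_mulDl : left_distributive galg_mul +%R.
Proof.
move=> u v w; apply/ffunP=> x; rewrite !ffunE -big_split.
by apply: eq_bigr => y _; rewrite ffunE mulrDl.
Qed.

Fact galg_mulDr : right_distributive galg_mul +%R.
Proof.
move=> u v w; apply/ffunP=> x; rewrite !ffunE -big_split.
by apply: eq_bigr => y _; rewrite ffunE mulrDr.
Qed.

Fact galg_one_neq0 : galg_one != 0.
Proof. by apply/eqP=> /ffunP/(_ 1%g)/eqP; rewrite !ffunE eqxx oner_eq0. Qed.

HB.instance Definition _ := GRing.Zmodule_isNzRing.Build A
  galg_mulA galg_mul1l galg_mul1r galg_mulDl galg_mulDr galg_one_neq0.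

Fact galg_scaleAl (a : R) u v : a *: (u * v) = a *: u * v.
Proof.
apply/ffunP=> x; rewrite !ffunE scaler_sumr.
by apply: eq_bigr => y _; rewrite ffunE scalerAl.
Qed.

HB.instance Definition _ := GRing.Lmodule_isLalgebra.Build R A galg_scaleAl.

Fact galg_scaleAr (a : R) u v : a *: (u * v) = u * (a *: v).
Proof.
apply/ffunP=> x; rewrite !ffunE scaler_sumr.
by apply: eq_bigr => y _; rewrite ffunE scalerAr.
Qed.

HB.instance Definition _ := GRing.Lalgebra_isAlgebra.Build R A galg_scaleAr.

End GroupAlgebra.

Definition alg_isomorphic (R : nzRingType) (A B : algType R) : Prop :=
  exists f : {lrmorphism A -> B}, bijective f.

Definition abelian_direct_factor (gT : finGroupType) (A G : {group gT}) : Prop :=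
  abelian A /\ exists K : {group gT}, (K \x A)%g = G.

Definition max_abelian_direct_factor (gT : finGroupType) (A G : {group gT}) :
    Prop :=
  abelian_direct_factor A G /\
  forall B : {group gT}, abelian_direct_factor B G -> (#|B| <= #|A|)%N.

(* Main.v *)
(* Let J be the augmentation ideal of FG, for a p-group G. Additive maps
   lam : G -> F, extended linearly to FG, are exactly the linear forms on J
   that vanish on J^2; since J is nilpotent, an algebra map into FG is onto as
   soon as no nonzero lam vanishes on its image.

   Write G = K x A and H = L x B with A and B the given abelian factors, and
   identify FG with FH. The composite FB -> FH = FG -> FA is onto: let lam on A
   vanish on its image. By induction on n, lam vanishes on the a in A with
   a^(p^n) = 1. Indeed lam pulls back to an additive map mu on H that is trivial
   on B, so lam(a) is the value of mu at the projection v of a to FL, where v is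
   central and (v - 1)^(p^n) = 0. Modulo p, noncentral classes of L do not
   contribute, and the coefficients of v - 1 over each fiber of z |-> z^(p^n) on
   Z(L) sum to zero, so it suffices that mu kills the z in Z(L) with
   z^(p^n) = 1. As L has no nontrivial cyclic direct factor, z^(p^(n-1)) =
   c k^(p^n) with c in L'; hence the images of z and k^p in the commutative ring
   FA have the same p^(n-1)-th power, and the induction hypothesis applied to
   their difference gives mu(z) = mu(k^p) = p mu(k) = 0.

   On the level of J/J^2, an isomorphism with an onto diagonal block has an onto
   complementary block in its inverse, so FK -> FG = FH -> FL is onto. By
   symmetry so is some map FL -> FK, and a dimension count concludes. *)

Require Import Defs.
From HB Require Import structures.
From mathcomp Require Import all_boot all_fingroup all_algebra all_solvable.
From mathcomp Require Import falgebra.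

Set Implicit Arguments.
Unset Strict Implicit.
Unset Printing Implicit Defensive.
Import GRing.Theory.
Local Open Scope ring_scope.

(** * Finite-dimensional algebra structure on the group algebra *)

Section FalgType.
Variables (F : fieldType) (gT : finGroupType) (G : {group gT}).
HB.instance Definition _ :=
  Vector.copy (group_algebra F G) {ffun subg_of G -> F^o}.
HB.instance Definition _ := Algebra_isFalgebra.Build F (group_algebra F G).
End FalgType.

(** * Algebra maps out of a group algebra *)

Section Basis.
Variables (F : fieldType) (gT : finGroupType) (G : {group gT}).
Local Notation A := (group_algebra F G).
Implicit Types (u v : A) (x y : subg_of G).

Definition galg_of x : A := [ffun y => (y == x)%:R].

Lemma galg_of1 : galg_of 1 = 1.
Proof. by apply/ffunP=> y; rewrite !ffunE. Qed.

Lemma galg_ofMl x v y : (galg_of x * v) y = v (x^-1 * y)%g.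
Proof.
rewrite ffunE (bigD1 x) //= ffunE eqxx mul1r big1 ?addr0 // => z zx.
by rewrite ffunE (negPf zx) mul0r.
Qed.

Lemma galg_ofMr x v y : (v * galg_of x) y = v (y * x^-1)%g.
Proof.
rewrite ffunE (bigD1 (y * x^-1)%g) //= ffunE invMg invgK mulgKV eqxx mulr1.
rewrite big1 ?addr0 // => z zx; rewrite ffunE -(inj_eq (mulgI z)) mulKVg.
by rewrite -(inj_eq (mulIg x^-1%g)) mulgK eq_sym (negPf zx) mulr0.
Qed.

Lemma galg_ofM x y : galg_of (x * y)%g = galg_of x * galg_of y.
Proof.
by apply/ffunP=> z; rewrite galg_ofMl !ffunE -(inj_eq (mulgI x^-1%g)) mulKg.
Qed.

Lemma galg_ofX x n : galg_of (x ^+ n)%g = galg_of x ^+ n.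
Proof.
by elim: n => [|n IHn]; rewrite ?galg_of1 // expgS exprS galg_ofM IHn.
Qed.

Lemma galg_sum u : u = \sum_x u x *: galg_of x.
Proof.
apply/ffunP=> y; rewrite sum_ffunE (bigD1 y) //= big1 => [|x xy].
  by rewrite !ffunE eqxx addr0 [_ *: _]mulr1.
by rewrite !ffunE eq_sym (negPf xy) [_ *: _]mulr0.
Qed.

Lemma galg_mulC_of u : (forall x, galg_of x * u = u * galg_of x) <->
  (forall v, v * u = u * v).
Proof.
split=> cu // v; rewrite [v]galg_sum mulr_suml mulr_sumr.
by apply: eq_bigr => x _; rewrite -scalerAl -scalerAr cu.
Qed.

End Basis.

Section Lift.
Variables (F : fieldType) (gT : finGroupType) (G : {group gT}).
Variables (B : algType F) (phi : subg_of G -> B).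

Definition galg_lift (u : group_algebra F G) : B := \sum_x u x *: phi x.

Lemma galg_lift_is_linear : linear galg_lift.
Proof.
move=> a u v; rewrite /galg_lift scaler_sumr -big_split /=.
by apply: eq_bigr => x _; rewrite !ffunE scalerDl scalerA.
Qed.

HB.instance Definition _ :=
  GRing.isLinear.Build F (group_algebra F G) B *:%R galg_lift
    galg_lift_is_linear.

Lemma galg_lift_of x : galg_lift (galg_of F x) = phi x.
Proof.
rewrite /galg_lift (bigD1 x) //= big1 => [|y yx].
  by rewrite ffunE eqxx scale1r addr0.
by rewrite ffunE (negPf yx) scale0r.
Qed.

Hypothesis phi1 : phi 1%g = 1.
Hypothesis phiM : forall x y, phi (x * y)%g = phi x * phi y.

Lemma galg_lift_is_multiplicative : monoid_morphism galg_lift.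
Proof.
split=> [|u v]; first by rewrite -galg_of1 galg_lift_of.
rewrite [u]galg_sum [v]galg_sum mulr_suml !linear_sum /= mulr_suml.
apply: eq_bigr => x _; rewrite mulr_sumr mulr_sumr linear_sum.
apply: eq_bigr => y _; rewrite -scalerAl -scalerAr !linearZ /= -galg_ofM.
by rewrite !galg_lift_of phiM -scalerAl -scalerAr.
Qed.

Definition galg_lift_lrmorphism : {lrmorphism group_algebra F G -> B} :=
  HB.pack_for {lrmorphism group_algebra F G -> B} galg_lift
    (GRing.isMonoidMorphism.Build _ _ galg_lift galg_lift_is_multiplicative).

End Lift.

Section Map.
Variables (F : fieldType) (gT hT : finGroupType).
Variables (G : {group gT}) (H : {group hT}) (phi : subg_of G -> subg_of H).
Hypothesis phiM : {morph phi : x y / (x * y)%g}.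

Fact galg_map_phi1 : galg_of F (phi 1%g) = 1.
Proof.
rewrite (_ : phi 1%g = 1%g) ?galg_of1 //; apply: (mulgI (phi 1%g)).
by rewrite -phiM !mulg1.
Qed.

Fact galg_map_phiM x y :
  galg_of F (phi (x * y)%g) = galg_of F (phi x) * galg_of F (phi y).
Proof. by rewrite phiM galg_ofM. Qed.

Definition galg_map : {lrmorphism group_algebra F G -> group_algebra F H} :=
  galg_lift_lrmorphism galg_map_phi1 galg_map_phiM.

Lemma galg_map_of x : galg_map (galg_of F x) = galg_of F (phi x).
Proof. exact: galg_lift_of. Qed.

End Map.

(** * Linear forms given by additive maps *)

Lemma exprDpn_comm (R : nzRingType) p n (x y : R) :
  p \in [pchar R] -> GRing.comm x y ->
  (x + y) ^+ (p ^ n) = x ^+ (p ^ n) + y ^+ (p ^ n).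
Proof.
move=> pR cxy; elim: n => [|n IHn] //.
rewrite expnSr !exprM IHn -!(pFrobenius_autE pR) pFrobenius_autD_comm //.
exact/commrX/commr_sym/commrX.
Qed.

Lemma exprBpn_comm (R : nzRingType) p n (x y : R) :
  p \in [pchar R] -> GRing.comm x y ->
  (x - y) ^+ (p ^ n) = x ^+ (p ^ n) - y ^+ (p ^ n).
Proof.
move=> pR cxy; apply/eqP; rewrite eq_sym subr_eq -exprDpn_comm ?subrK //.
exact/commr_sym/commrB/commr_refl.
Qed.

Lemma expr_sum_pn (R : nzRingType) p n (I : finType) (P : pred I) (f : I -> R) :
  p \in [pchar R] -> {in P &, forall i j, GRing.comm (f i) (f j)} ->
  (\sum_(i | P i) f i) ^+ (p ^ n) = \sum_(i | P i) f i ^+ (p ^ n).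
Proof.
move=> pR cf; rewrite -big_filter -[RHS]big_filter.
have: {subset filter P (index_enum I) <= P}.
  by move=> i; rewrite mem_filter => /andP[].
elim: (filter _ _) => [|i s IHs] sP.
  by rewrite !big_nil expr0n gtn_eqF ?expn_gt0 ?prime_gt0 ?(pcharf_prime pR).
have sP': {subset s <= P} by move=> j js; rewrite sP // inE js orbT.
rewrite !big_cons exprDpn_comm ?IHs // big_seq; apply: commr_sum => j js.
by apply: cf; rewrite sP // inE ?eqxx // js orbT.
Qed.

Lemma field_expp_eq1 (F : fieldType) p n (c : F) :
  p \in [pchar F] -> c ^+ (p ^ n) = 1 -> c = 1.
Proof.
move=> pF c1; apply/eqP; rewrite -subr_eq0.
have: (c - 1) ^+ (p ^ n) == 0.
  by rewrite exprBpn_comm ?c1 ?expr1n ?subrr //; apply: commr1.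
by rewrite expf_eq0 => /andP[].
Qed.

Section Tangent.
Variables (F : fieldType) (gT : finGroupType) (G : {group gT}).
Local Notation A := (group_algebra F G).
Implicit Types (u v : A) (x y : subg_of G) (lam : subg_of G -> F).

Definition galg_form lam : A -> F^o := galg_lift (lam : _ -> F^o).
HB.instance Definition _ lam := GRing.Linear.on (galg_form lam).

Lemma galg_formE lam u : galg_form lam u = \sum_x u x * lam x.
Proof. by []. Qed.

Lemma galg_form_of lam x : galg_form lam (galg_of F x) = lam x.
Proof. exact: galg_lift_of. Qed.

Definition galg_aug := galg_form (fun=> 1).
HB.instance Definition _ := GRing.Linear.on galg_aug.
HB.instance Definition _ :=
  GRing.isMonoidMorphism.Build A F^o galg_aug
    (@galg_lift_is_multiplicative F gT G F^o (fun=> 1)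
       (erefl _) (fun x y => esym (mulr1 1))).

Lemma galg_aug_of x : galg_aug (galg_of F x) = 1.
Proof. exact: galg_form_of. Qed.

Definition additive_char lam := forall x y, lam (x * y)%g = lam x + lam y.

Lemma additive_char1 lam : additive_char lam -> lam 1%g = 0.
Proof. by move=> lamD; apply: (addIr (lam 1%g)); rewrite -lamD mul1g add0r. Qed.

Lemma additive_charX lam x n : additive_char lam -> lam (x ^+ n)%g = lam x *+ n.
Proof.
move=> lamD; elim: n => [|n IHn]; first exact: additive_char1.
by rewrite expgS lamD IHn mulrS.
Qed.

Lemma galg_form1 lam : additive_char lam -> galg_form lam 1 = 0.
Proof. by move=> lamD; rewrite -galg_of1 galg_form_of additive_char1. Qed.

(** The form of an additive map is a derivation at the augmentation; this is why it kills products
    of two elements of augmentation zero. *)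
Lemma galg_formM lam u v : additive_char lam ->
  galg_form lam (u * v) = galg_form lam u * galg_aug v
                          + galg_aug u * galg_form lam v.
Proof.
move=> lamD; rewrite [u]galg_sum [v]galg_sum mulr_suml !linear_sum /=.
rewrite !mulr_suml -big_split; apply: eq_bigr => x _ /=.
rewrite !mulr_sumr -big_split linear_sum; apply: eq_bigr => y _ /=.
rewrite -scalerAl -scalerAr !linearZ /= -galg_ofM.
rewrite !(galg_form_of, galg_aug_of) lamD.
rewrite /GRing.scale /= !mulr1 mulrDr mulrDr mulrA mulrA; congr (_ + _).
by rewrite mulrAC.
Qed.

End Tangent.

Section Pullback.
Variables (F : fieldType) (p : nat) (gT hT : finGroupType).
Variables (H : {group hT}) (G : {group gT}).
Hypotheses (pF : p \in [pchar F]) (pH : (p.-group H)%g).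
Variable q : {lrmorphism group_algebra F H -> group_algebra F G}.

Lemma pgroup_subg_expg (x : subg_of H) :
  exists n, (x ^+ (p ^ n))%g = 1%g.
Proof.
have [n oG] := p_natP pH; exists n; apply: val_inj => /=.
have sgX m : sgval (x ^+ m)%g = (sgval x ^+ m)%g.
  by elim: m => //= m IHm; rewrite !expgS -IHm.
by rewrite sgX -oG; apply: expg_cardG; apply: valP.
Qed.

(** The value is a root of unity of [p]-power order, and 1 is the only one in characteristic [p].
    Hence any algebra map [q] respects augmentations, with no normalization assumed. *)
Lemma galg_aug_morph (x : subg_of H) : galg_aug (q (galg_of F x)) = 1.
Proof.
have [n xn] := pgroup_subg_expg x; apply: (@field_expp_eq1 _ p n) => //.
rewrite -[_ ^+ _](rmorphXn (@galg_aug F gT G)) -rmorphXn -galg_ofX xn.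
by rewrite galg_of1 !rmorph1.
Qed.

Lemma additive_char_pullback (lam : subg_of G -> F) : additive_char lam ->
  additive_char (fun x => galg_form lam (q (galg_of F x))).
Proof.
move=> lamD x y; rewrite galg_ofM rmorphM galg_formM // !galg_aug_morph.
by rewrite mulr1 mul1r.
Qed.

Lemma galg_form_pullback (lam : subg_of G -> F) u :
  galg_form lam (q u) = galg_form (fun x => galg_form lam (q (galg_of F x))) u.
Proof.
rewrite {1}[u]galg_sum !linear_sum galg_formE; apply: eq_bigr => x _.
by rewrite !linearZ.
Qed.

End Pullback.

(** * Nilpotent central elements *)

(** A noncentral class has size a positive power of [p], so a class function sums to zero over
    it. *)
Lemma sum_class_fun (R : nzRingType) (p : nat) (gT : finGroupType)
    (G : {group gT}) (s : gT -> R) :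
    p \in [pchar R] -> (p.-group G)%g ->
    {in G &, forall x y, s (x ^ y)%g = s x} ->
  \sum_(x in G) s x = \sum_(x in 'Z(G)%g) s x.
Proof.
move=> pR pG sJ; rewrite (big_setID 'Z(G)%g) /= setIC.
rewrite (setIidPl (center_sub G)) -[RHS]addr0; congr (_ + _).
(* Extending by zero over the centre turns the remaining sum into one over all of [G], which the
   classes partition. *)
transitivity (\sum_(x in G) if x \in 'Z(G)%g then 0 else s x).
  rewrite [RHS](big_setID 'Z(G)%g) /= [X in _ = X + _]big1 ?add0r => [|x].
    by apply: eq_bigr => x /setDP[_ /negPf->].
  by case/setIP=> _ ->.
rewrite (set_partition_big _ (classes_partition G)) /=.
apply: big1 => _ /imsetP[x Gx ->].
have [Zx | nZx] := boolP (x \in 'Z(G)%g).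
  apply: big1 => _ /imsetP[y Gy ->]; rewrite ifT //.
  by rewrite memJ_norm // (subsetP (normal_norm (center_normal G))).
rewrite (eq_bigr (fun=> s x)) => [|_ /imsetP[y Gy ->]]; last first.
  rewrite sJ // ifF // memJ_norm ?(negPf nZx) //.
  by rewrite (subsetP (normal_norm (center_normal G))).
rewrite sumr_const -mulr_natr; apply/eqP; rewrite (_ : _%:R = 0) ?mulr0 //.
apply/eqP; rewrite -(dvdn_pcharf pR) -index_cent1.
have [n iG] := p_natP (pnat_dvd (dvdn_indexg G 'C_G[x]%g) pG).
case: n iG => [/eqP|n ->]; last by rewrite expnS dvdn_mulr.
rewrite indexg_eq1 subsetI subxx /= sub_cent1 => cGx.
by case/negP: nZx; rewrite inE Gx.
Qed.

Section CentralRestriction.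
Variables (F : fieldType) (p : nat) (gT : finGroupType) (G : {group gT}).
Hypotheses (pF : p \in [pchar F]) (pG : (p.-group G)%g).
Local Notation A := (group_algebra F G).
Implicit Types (u v : A) (x y : subg_of G).

Local Notation Z := 'Z([set: subg_of G])%g.

Lemma pgroup_subg : (p.-group [set: subg_of G])%g.
Proof. by rewrite /pgroup -(card_isog (isog_subg G)). Qed.

Lemma galg_pchar : p \in [pchar A].
Proof. by rewrite pchar_lalg. Qed.

Definition galg_central u := forall v, v * u = u * v.

Lemma galg_centralP u : galg_central u <-> forall x y, u (x ^ y)%g = u x.
Proof.
split=> [cu x y | cu].
  have /ffunP/(_ (x * y)%g) := cu (galg_of F y).
  by rewrite galg_ofMl galg_ofMr mulgK -conjgE.
apply/galg_mulC_of => x; apply/ffunP=> y.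
by rewrite galg_ofMl galg_ofMr -[in LHS](mulgKV x y) -conjgE cu.
Qed.

Lemma sum_class_galg (s : subg_of G -> F) :
    (forall x y, s (x ^ y)%g = s x) -> \sum_x s x = \sum_(x in Z) s x.
Proof.
move=> sJ; rewrite -(sum_class_fun pF pgroup_subg) => [|x y _ _].
  by apply: eq_bigl => x; rewrite inE.
exact: sJ.
Qed.

Definition galg_restr u : A := [ffun x => if x \in Z then u x else 0].

(* The noncentral class sums span an ideal of the centre of FG complementary to
   F[Z(G)]: a product of such a sum with a central element of FG has zero
   coefficients on Z(G), these being sums over noncentral classes. *)
Lemma galg_restrM u v : galg_central u -> galg_central v ->
  galg_restr (u * v) = galg_restr u * galg_restr v.
Proof.
move=> /galg_centralP cu /galg_centralP cv; apply/ffunP=> x.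
rewrite ![in RHS]ffunE (bigID [in Z]) /= addrC big1 ?add0r => [|y /negPf nZy].
  rewrite ffunE; case: ifPn => Zx.
    rewrite ffunE (sum_class_galg (s := fun y => u y * v (y^-1 * x)%g)).
      by apply: eq_bigr => y Zy; rewrite !ffunE Zy groupMl ?groupV ?Zx.
    move=> y z; rewrite cu; congr (_ * _); rewrite -[RHS](cv _ z); congr (v _).
    rewrite conjMg -conjVg; congr (_ * _)%g.
    by have /centerP[_ cx] := Zx; rewrite [(x ^ z)%g]conjgE cx ?inE // mulKg.
  apply/esym/big1 => y Zy; rewrite !ffunE Zy groupMl ?groupV ?(negPf Zx) //.
  by rewrite mulr0.
by rewrite !ffunE nZy mul0r.
Qed.

Lemma galg_centralM u v : galg_central u -> galg_central v ->
  galg_central (u * v).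
Proof. by move=> cu cv w; rewrite mulrA cu -mulrA cv mulrA. Qed.

Lemma galg_restrX u n : galg_central u ->
  galg_restr (u ^+ n) = galg_restr u ^+ n.
Proof.
move=> cu; have cX m : galg_central (u ^+ m).
  elim: m => [|m IHm]; first by move=> v; rewrite mul1r mulr1.
  by rewrite exprS; apply: galg_centralM.
elim: n => [|n IHn]; last by rewrite !exprS galg_restrM ?IHn.
apply/ffunP=> x; rewrite !expr0 !ffunE; case: ifPn => // nZx.
by case: eqP nZx => // ->; rewrite group1.
Qed.

(** The form reduces to a sum over the centre, which is cut into the fibers of [z ^+ (p ^ n)]. On a
    fiber [lam] is constant, since two of its elements differ by a central element killed by
    [p ^ n], and the coefficients of [u] on it sum to zero. *)
Lemma galg_form_nilpotent_central n u (lam : subg_of G -> F) :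
    galg_central u -> u ^+ (p ^ n) = 0 -> additive_char lam ->
    (forall z, z \in Z -> z ^+ (p ^ n) = 1 -> lam z = 0)%g ->
  galg_form lam u = 0.
Proof.
move=> cu un0 lamD lam0.
have /galg_centralP cuJ := cu.
have lamJ x y : lam (x ^ y)%g = lam x.
  by rewrite conjgE !lamD addrCA -(lamD y^-1%g) mulVg additive_char1 // addr0.
rewrite galg_formE (sum_class_galg (s := fun x => u x * lam x)); last first.
  by move=> x y; rewrite cuJ lamJ.
rewrite (partition_big_imset (fun z => z ^+ (p ^ n))%g) /=.
apply: big1 => y _.
(* By Frobenius in the commutative algebra of the centre, the [p ^ n]-th power of this sum is the
   coefficient at [y] of [galg_restr u ^+ (p ^ n)], which is zero. *)
have sum0: \sum_(z in Z | (z ^+ (p ^ n))%g == y) u z = 0.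
  have: (galg_restr u ^+ (p ^ n)) y = 0.
    by rewrite -galg_restrX // un0 !ffunE if_same.
  rewrite [galg_restr u]galg_sum (bigID [in Z]) /=.
  rewrite [X in _ + X]big1 ?addr0 => [|z /negPf nZz]; last first.
    by rewrite ffunE nZz scale0r.
  rewrite expr_sum_pn ?galg_pchar // => [|z t Zz Zt]; last first.
    rewrite /GRing.comm -!scalerAl -!scalerAr -!galg_ofM !scalerA mulrC.
    by have /centerP[_ ->] := Zz; rewrite ?inE.
  rewrite sum_ffunE => sum0.
  have: (\sum_(z in Z | (z ^+ (p ^ n))%g == y) u z) ^+ (p ^ n) == 0.
    rewrite expr_sum_pn // => [|z t _ _]; last exact: mulrC.
    rewrite big_mkcondr; apply/eqP/(etrans _ sum0)/eq_bigr => z Zz.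
    rewrite exprZn -galg_ofX !ffunE Zz eq_sym.
    by case: eqP => _; rewrite [_ *: _]mulr_natr.
  by rewrite expf_eq0 => /andP[_ /eqP].
have [/existsP[z0 /andP[Zz0 /eqP z0y]] | /existsPn noz] :=
    boolP [exists z, (z \in Z) && ((z ^+ (p ^ n))%g == y)]; last first.
  by apply: big1 => z /andP[Zz zy]; case/negP: (noz z); rewrite Zz.
transitivity ((\sum_(z in Z | (z ^+ (p ^ n))%g == y) u z) * lam z0); last first.
  by rewrite sum0 mul0r.
rewrite mulr_suml; apply: eq_bigr => z /andP[Zz /eqP zy]; congr (_ * _).
rewrite -[z](mulgKV z0) lamD lam0 ?add0r ?groupM ?groupV //.
rewrite expgMn ?expgVn ?z0y ?zy ?mulgV //.
by apply/commuteV; have /centerP[_ cz] := Zz; apply: cz; rewrite inE.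
Qed.

End CentralRestriction.

(** * The augmentation ideal *)

Definition galg_augv (F : fieldType) (gT : finGroupType) (G : {group gT}) :
  {vspace group_algebra F G} := lker (linfun (@galg_aug F gT G)).

Lemma mem_galg_augv (F : fieldType) (gT : finGroupType) (G : {group gT})
  (u : group_algebra F G) : (u \in galg_augv F G) = (galg_aug u == 0).
Proof. by rewrite memv_ker lfunE. Qed.

(** For central [c] the image of [amull c] is the two-sided ideal generated by [c], and the factors
    [c] of a product can be collected in front. *)
Lemma limg_amull_exp (F : fieldType) (A : falgType F) (c : A) n :
  (forall v, v * c = c * v) ->
  (limg (amull c) ^+ n <= limg (amull (c ^+ n)%R))%VS.
Proof.
move=> cc; elim: n => [|n IHn].
  apply/subvP=> u _; rewrite expr0; apply/memv_imgP; exists u.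
    exact: memvf.
  by rewrite lfunE /= mul1r.
rewrite expvSl; apply/prodvP=> _ v /memv_imgP[u _ ->] /(subvP IHn).
case/memv_imgP=> w _ ->; apply/memv_imgP; exists (u * w); rewrite ?memvf //.
have cX m : u * c ^+ m = c ^+ m * u.
  by apply: commrX; apply: cc.
by rewrite !lfunE /= exprS -!mulrA [u * (_ * w)]mulrA cX !mulrA.
Qed.

Section CyclicKernel.
Variables (F : fieldType) (gT hT : finGroupType).
Variables (G : {group gT}) (H : {group hT}).
Variables (phi : subg_of G -> subg_of H) (z : subg_of G).
Hypothesis ker_phi : forall x y, phi x = phi y -> exists i, x = (z ^+ i * y)%g.
Variable f : {lrmorphism group_algebra F G -> group_algebra F H}.
Hypothesis f_of : forall x, f (galg_of F x) = galg_of F (phi x).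

(** Let [rho] choose preimages under [phi]. Lifting [f u = 0] along [rho] rewrites [u] as a
    combination of the differences of [x] and [rho (phi x)]. These two differ by some [z ^+ i], and
    [z - 1] divides [z ^+ i - 1]. *)
Lemma galg_ker_cyclic u :
  f u = 0 -> u \in limg (amull (galg_of F z - 1)).
Proof.
(* The default [z] is immaterial: [rho] is only evaluated at points [phi x]. *)
move=> fu0; pose rho y := odflt z [pick x | phi x == y].
have rhoP x : phi (rho (phi x)) = phi x.
  by rewrite /rho; case: pickP => [w /eqP //| /(_ x)]; rewrite eqxx.
have: galg_lift (fun y => galg_of F (rho y)) (f u) = 0 by rewrite fu0 linear0.
rewrite {1}[u]galg_sum !linear_sum /= => sum0.
rewrite [u]galg_sum -[X in X \in _]subr0 -[X in _ - X]sum0 -sumrB.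
apply: memv_suml => x _; rewrite !linearZ /= f_of galg_lift_of -scalerDr.
apply: memvZ.
have [i {1}->] := ker_phi (esym (rhoP x)).
apply/memv_imgP.
exists ((\sum_(j < i) galg_of F z ^+ j) * galg_of F (rho (phi x))).
  exact: memvf.
by rewrite lfunE /= mulrA -subrX1 mulrBl mul1r galg_ofM galg_ofX.
Qed.

Hypothesis f_aug : forall u, galg_aug (f u) = galg_aug u.

Lemma galg_augv_map n u :
  u \in (galg_augv F G ^+ n)%VS -> f u \in (galg_augv F H ^+ n)%VS.
Proof.
move=> Ju; rewrite -[f u](lfunE f) memv_preim.
apply: subvP Ju; elim: n => [|n IHn].
  apply/subvP=> _ /vlineP[k ->]; rewrite -memv_preim lfunE /= linearZ /=.
  by rewrite rmorph1 memvZ // memv_line.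
rewrite !expvSl; apply/prodvP=> v w; rewrite mem_galg_augv => v0 /(subvP IHn).
rewrite -!memv_preim !lfunE /= rmorphM => Jw.
by apply: memv_mul => //; rewrite mem_galg_augv f_aug.
Qed.

End CyclicKernel.

(* For z of order p in Z(G), induction gives n with J^n inside (z - 1)FG, and
   (z - 1)^p = z^p - 1 = 0. *)
Theorem galg_augv_nilpotent (F : fieldType) (p : nat) (gT : finGroupType)
    (G : {group gT}) : p \in [pchar F] -> (p.-group G)%g ->
  exists n, (galg_augv F G ^+ n = 0)%VS.
Proof.
move=> pF; have p_pr := pcharf_prime pF.
have [m] := ubnP #|G|; elim: m => // m IHm in gT G * => ltGm pG.
have [G1 | ntG] := eqsVneq G 1%G.
  exists 1%N; rewrite expv1; apply/eqP; rewrite -subv0; apply/subvP=> u.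
  rewrite mem_galg_augv /galg_aug galg_formE => u0.
  have x1 (x : subg_of G) : x = 1%g.
    have sG1 : (G \subset [1])%g by rewrite G1.
    by apply/val_inj/set1P/(subsetP sG1)/valP.
  rewrite memv0; apply/eqP/ffunP=> x; rewrite ffunE; apply/eqP.
  rewrite (bigD1 x) //= big1 ?addr0 ?mulr1 in u0 => // y.
  by rewrite (x1 y) (x1 x) eqxx.
have /trivgPn[z0 Zz0 ntz0]: 'Z(G)%g != 1%g.
  by rewrite (center_nil_eq1 (pgroup_nil pG)).
have pZ : (p %| #|'Z(G)%g|)%N.
  have [|_ //] := pgroup_pdiv (pgroupS (center_sub G) pG).
  by apply/trivgPn; exists z0.
have [z Zz oz] := Cauchy p_pr pZ.
have Gz : z \in G by apply: subsetP Zz; apply: center_sub.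
pose N := <[z]>%G.
have nsNG : (N <| G)%g.
  by apply: sub_center_normal; rewrite cycle_subG.
have pQ : (p.-group (G / N))%g by apply: quotient_pgroup.
have [|n JQ0] := IHm _ (G / N)%G _ pQ.
  apply: leq_trans (ltn_quotient _ (normal_sub nsNG)) ltGm.
  by rewrite cycle_eq1 -order_gt1 oz prime_gt1.
pose phi (x : subg_of G) : subg_of (G / N)%G := subg _ (coset N (sgval x)).
have phiK x : sgval (phi x) = coset N (sgval x).
  by rewrite subgK // mem_quotient // subgP.
have nN (x : subg_of G) : sgval x \in 'N(N)%g.
  by apply: subsetP (subgP x); apply: normal_norm.
have phiM x y : phi (x * y)%g = (phi x * phi y)%g.
  by apply: val_inj; rewrite /= !phiK /= morphM.
have [f fE] : exists f :
      {lrmorphism group_algebra F G -> group_algebra F (G / N)%G},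
    forall x, f (galg_of F x) = galg_of F (phi x).
  by exists (galg_map F phiM) => x; apply: galg_map_of.
pose zs := subg G z.
have zsX i : sgval (zs ^+ i)%g = (z ^+ i)%g.
  elim: i => [|i IHi]; first by [].
  by rewrite !expgS -IHi /= subgK.
have kerphi x y : phi x = phi y -> exists i, x = (zs ^+ i * y)%g.
  move/(congr1 val); rewrite /= !phiK => /(rcoset_kercosetP (nN x) (nN y)).
  case/rcosetP=> _ /cycleP[i ->] xE; exists i; apply: val_inj.
  by rewrite /= xE zsX.
have f_aug u : galg_aug (f u) = galg_aug u.
  rewrite [u]galg_sum !linear_sum; apply: eq_bigr => x _.
  by rewrite !linearZ /= fE !galg_aug_of.
have cz (v : group_algebra F G) :
  v * (galg_of F zs - 1) = (galg_of F zs - 1) * v.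
  rewrite mulrBl mulrBr mul1r mulr1; congr (_ - _); move: v.
  apply/galg_mulC_of => x; rewrite -!galg_ofM.
  congr galg_of; apply: val_inj => /=.
  by rewrite subgK //; have /centerP[_ ->] := Zz; rewrite ?subgP.
exists (n * p)%N; apply/eqP; rewrite -subv0 expvM.
apply: subv_trans (_ : (limg (amull (galg_of F zs - 1)%R) ^+ p <= _)%VS).
  apply: expvS; apply/subvP=> u /(galg_augv_map f_aug).
  rewrite JQ0 memv0 => /eqP; exact: (galg_ker_cyclic kerphi fE).
apply: subv_trans (limg_amull_exp _ cz) _.
rewrite -[p]expn1 exprBpn_comm ?expr1n ?galg_pchar //; last exact: commr1.
have -> : galg_of F zs ^+ (p ^ 1) = 1.
  rewrite -galg_ofX -galg_of1; congr galg_of; apply: val_inj => /=.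
  by rewrite zsX expn1 -oz expg_order.
rewrite subrr; apply/subvP=> _ /memv_imgP[v _ ->].
by rewrite lfunE /= mul0r mem0v.
Qed.

(** Every linear form is [galg_form lam] for its values [lam] on group elements. The coordinates of
    [v - projv W v] are such forms; they vanish on [W], and jointly vanish only there. *)
Lemma galg_form_separates (F : fieldType) (gT : finGroupType) (G : {group gT})
    (W : {vspace group_algebra F G}) :
    (forall lam : subg_of G -> F,
       (forall w, w \in W -> galg_form lam w = 0) -> forall x, lam x = 0) ->
  W = fullv.
Proof.
move=> sepW; apply/vspaceP=> u; rewrite memvf; apply/idP.
have [//|nWu] := boolP (u \in W).
suff: u - projv W u = 0 by move/subr0_eq=> uE; rewrite uE memv_proj in nWu.
apply/ffunP=> y; rewrite [RHS]ffunE.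
pose lam x : F := (galg_of F x - projv W (galg_of F x)) y.
have lamE v : galg_form lam v = (v - projv W v) y.
  rewrite {2 3}[v]galg_sum linear_sum -sumrB sum_ffunE.
  by apply: eq_bigr => x _; rewrite linearZ -scalerBr [in RHS]ffunE.
rewrite -lamE galg_formE big1 // => x _; rewrite (sepW lam) ?mulr0 // => w Ww.
by rewrite lamE projv_id // subrr ffunE.
Qed.

(* If S is the image, separation gives FG = S + J^2; multiplying out,
   J is contained in S + J^k for every k. *)
Theorem galg_surjective (F : fieldType) (p : nat) (xT gT : finGroupType)
    (X : {group xT}) (G : {group gT})
    (q : {lrmorphism group_algebra F X -> group_algebra F G}) :
    p \in [pchar F] -> (p.-group G)%g ->
    (forall lam : subg_of G -> F, additive_char lam ->
       (forall u, galg_form lam (q u) = 0) -> forall x, lam x = 0) ->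
  limg (linfun q) = fullv.
Proof.
move=> pF pG sepq; pose S := limg (linfun q); pose J := galg_augv F G.
have Sq u : q u \in S by rewrite -[q u]lfunE memv_img ?memvf.
have S1 : 1 \in S by rewrite -(rmorph1 q) Sq.
have J_of x : galg_of F x - 1 \in J.
  by rewrite mem_galg_augv linearB /= galg_aug_of rmorph1 subrr.
(* A form vanishing at 1 and on every product of [x - 1] and [y - 1] is additive on the group, so
   [sepq] applies to it. *)
have fullS : (S + J * J = fullv)%VS.
  apply: galg_form_separates => lam lam0.
  have lamS w : w \in S -> galg_form lam w = 0.
    by move=> Sw; rewrite lam0 // (subvP (addvSl _ _)).
  apply: sepq => [x y|u]; last exact: lamS.
  have: galg_form lam ((galg_of F x - 1) * (galg_of F y - 1)) = 0.
    by rewrite lam0 // (subvP (addvSr _ _)) // memv_mul.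
  rewrite mulrBl !mulrBr !mul1r mulr1 -galg_ofM !linearB /= (lamS 1) //.
  rewrite !galg_form_of !oppr0 addr0 -addrA -opprD => /eqP.
  by rewrite subr_eq0 => /eqP.
pose T := (S :&: J)%VS.
have sJJ : (J * J <= J)%VS.
  apply/prodvP=> u v; rewrite !mem_galg_augv => /eqP u0 _.
  by rewrite rmorphM /= u0 mul0r.
(* Modular law: as [J * J] lies in [J], intersecting [S + J * J] with [J] only cuts [S] down to
   [T]. *)
have JE : (J <= T + J * J)%VS.
  by rewrite /T capvC vspace_modr // fullS capvf.
have sSS : (S * S <= S)%VS.
  apply/prodvP=> _ _ /memv_imgP[u _ ->] /memv_imgP[v _ ->].
  by rewrite !lfunE /= -rmorphM Sq.
have sTT : (T * T <= T)%VS.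
  rewrite subv_cap (subv_trans _ sSS) ?prodvS ?capvSl //.
  by rewrite (subv_trans _ sJJ) ?prodvS ?capvSr.
have [n Jn0] := galg_augv_nilpotent pF pG.
(* In [J * J] both factors are expanded by the induction hypothesis: [T * T] stays in [T], and each
   other product lies in [J ^+ k.+2]. *)
have sJT k : (J <= T + J ^+ k.+1)%VS.
  elim: k => [|k IHk]; first by rewrite expv1 addvSr.
  apply: subv_trans JE _; rewrite subv_add addvSl /=.
  apply: subv_trans (prodvSl _ IHk) _.
  rewrite prodvDl subv_add -expvSr addvSr andbT.
  apply: subv_trans (prodvSr _ IHk) _; rewrite prodvDr.
  by apply: addvS => //; rewrite [(J ^+ k.+2)%VS]expvSl prodvSl // capvSr.
have sJS : (J <= S)%VS.
  apply: subv_trans (sJT n) _; rewrite expvSl Jn0 prodv0 addv0; exact: capvSl.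
apply/vspaceP=> u; rewrite memvf; apply/idP.
rewrite -[u](subrK (galg_aug u *: 1)) memvD ?memvZ //.
apply: (subvP sJS); rewrite mem_galg_augv linearB linearZ /= rmorph1.
by rewrite [_ *: _]mulr1 subrr.
Qed.

(** * Cyclic direct factors *)

Section CyclicFactors.
Local Open Scope group_scope.

Lemma order_pfactor (gT : finGroupType) (p n : nat) (x : gT) : prime p ->
  x ^+ (p ^ n.+1) = 1 -> x ^+ (p ^ n) != 1 -> #[x] = (p ^ n.+1)%N.
Proof.
move=> p_pr xn1 ntx.
have /(dvdn_pfactor _ _ p_pr)[k lek ox] : (#[x] %| p ^ n.+1)%N.
  by rewrite order_dvdn xn1.
rewrite ox; congr (p ^ _)%N; apply/eqP; rewrite eqn_leq lek ltnNge.
by apply: contra ntx => lekn; rewrite -order_dvdn ox dvdn_exp2l.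
Qed.

(** A nontrivial intersection would contain the unique subgroup of order [p] of [<[x]>], which
    [x ^+ (p ^ n)] generates. *)
Lemma cycle_TI_pfactor (gT : finGroupType) (p n : nat) (x : gT)
    (N : {group gT}) :
  prime p -> #[x] = (p ^ n.+1)%N -> x ^+ (p ^ n) \notin N -> <[x]> :&: N = 1.
Proof.
move=> p_pr ox nNx; rewrite setIC; apply: TI_Ohm1.
have px : p.-elt x by rewrite /p_elt ox pnatX pnat_id.
rewrite (Ohm_p_cycle _ px) ox pfactorK // subn1 /= setIC.
rewrite prime_TIg ?cycle_subG //.
by rewrite -orderE orderXdiv ox ?expnS ?dvdn_mull // mulnK ?expn_gt0 ?prime_gt0.
Qed.

(** The complement is the preimage of [K]: an element of it in [<[x]>] has trivial image, hence lies
    in [N], which meets [<[x]>] trivially. *)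
Lemma central_cycle_dprod_lift (gT : finGroupType) (N L : {group gT}) x
    (K : {group coset_of N}) :
    N <| L -> x \in 'Z(L) -> <[x]> :&: N = 1 ->
    K \x <[coset N x]> = L / N ->
  exists M : {group gT}, M \x <[x]> = L.
Proof.
move=> nsNL Zx tiN /dprodP[_ defQ _ tiK].
have /centerP[Lx cLx] := Zx; have nNL := normal_norm nsNL.
exists (coset N @*^-1 K)%G; have sKQ : K \subset L / N.
  by rewrite -defQ mulG_subl.
have sML : coset N @*^-1 K \subset L.
  by rewrite sub_cosetpre_quo.
rewrite dprodE /=.
- apply/eqP; rewrite eqEsubset mul_subG ?cycle_subG //=; apply/subsetP=> g Lg.
  have : coset N g \in L / N by apply: mem_quotient.
  rewrite -defQ => /mulsgP[k _ Kk /cycleP[i ->] gE].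
  have nNg := subsetP nNL g Lg; have nNx := subsetP nNL x Lx.
  rewrite -(mulgKV (x ^+ i) g) mem_mulg ?mem_cycle //.
  rewrite mem_morphpre ?groupM ?groupV ?groupX //= morphM ?groupV ?groupX //.
  by rewrite morphV ?groupX //= morphX //= gE mulgK.
- rewrite cycle_subG; apply/centP=> y My; apply: cLx; exact: (subsetP sML).
apply/trivgP; rewrite -tiN subsetI subsetIr /=.
apply/subsetP=> y /setIP[My /cycleP[i yE]]; rewrite {y}yE in My *.
have nNx := subsetP nNL x Lx.
apply: coset_idr; first exact: groupX.
have /morphpreP[_ /= Kxi] := My.
by apply/set1gP; rewrite -tiK inE Kxi morphX // mem_cycle.
Qed.

(** Modulo ['Mho^n.+1(Q)] the image of [x] keeps its order [p ^ n.+1], now equal to the exponent. A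
    cyclic subgroup of maximal order splits off an abelian group, and the complement lifts. *)
Lemma abelian_cycle_dprod (gT : finGroupType) (p n : nat) (Q : {group gT}) x :
    p.-group Q -> abelian Q -> prime p -> x \in Q ->
    x ^+ (p ^ n.+1) = 1 -> x ^+ (p ^ n) \notin 'Mho^n.+1(Q) ->
  exists M : {group gT}, M \x <[x]> = Q.
Proof.
move=> pQ cQQ p_pr Qx xn1 nMx; pose N := 'Mho^n.+1(Q)%G.
have nsNQ : N <| Q by apply: Mho_normal.
have nNQ := normal_norm nsNQ; have nNx := subsetP nNQ x Qx.
have ntx : x ^+ (p ^ n) != 1 by apply: contraNneq nMx => ->.
have ox := order_pfactor p_pr xn1 ntx.
have oxN : #[coset N x] = (p ^ n.+1)%N.
  apply: order_pfactor => //; first by rewrite -morphX // xn1 morph1.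
  rewrite -morphX //; apply: contraNneq nMx => x1.
  by apply: coset_idr; rewrite ?groupX.
have cQN : abelian (Q / N) by apply: quotient_abelian.
have QNx : coset N x \in Q / N by apply: mem_quotient.
have eQN : #[coset N x] = exponent (Q / N).
  apply/eqP; rewrite eqn_dvd dvdn_exponent //= oxN; apply/exponentP=> y.
  case/morphimP=> z nNz Qz ->; rewrite -morphX //= coset_id //.
  by rewrite (MhoEabelian _ pQ cQQ); apply: imset_f.
have /splitsP[K /complP[tiK defQ]] := abelian_splits QNx eQN cQN.
apply: (central_cycle_dprod_lift (K := K) nsNQ).
- by rewrite (center_idP cQQ).
- exact: cycle_TI_pfactor nMx.
have sKQ : K \subset Q / N by rewrite -defQ mulG_subr.
have cKx : <[coset N x]> \subset 'C(K).
  by apply: centSS sKQ cQN; rewrite cycle_subG.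
by rewrite dprodE //; [rewrite -(centC cKx) | rewrite setIC].
Qed.

(** If the image of [z ^+ (p ^ n)] in the abelianization were not a [p ^ n.+1]-th power, the image
    of [z] would generate a direct factor there, and [<[z]>] would then be a nontrivial direct
    factor of [L]. *)
Lemma central_exp_in_Mho_der (gT : finGroupType) (p n : nat) (L : {group gT})
    z :
    p.-group L -> prime p ->
    (forall (M : {group gT}) x, M \x <[x]> = L -> x = 1) ->
    z \in 'Z(L) -> z ^+ (p ^ n.+1) = 1 ->
  exists k c, [/\ k \in L, c \in L^`(1) & z ^+ (p ^ n) = c * k ^+ (p ^ n.+1)].
Proof.
move=> pL p_pr noL Zz zn1; have /centerP[Lz _] := Zz.
pose N := L^`(1)%G; have nsNL : N <| L by apply: der_normal.
have nNL := normal_norm nsNL; have nNz := subsetP nNL z Lz.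
have cQ : abelian (L / N) by apply: sub_der1_abelian.
have pQ : p.-group (L / N) by apply: quotient_pgroup.
have [|nMz] := boolP (coset N z ^+ (p ^ n) \in 'Mho^n.+1(L / N)).
  rewrite (MhoEabelian _ pQ cQ) => /imsetP[_ /morphimP[k nNk Lk ->]].
  rewrite -!morphX // => /rcoset_kercosetP => /(_ _ _)/rcosetP.
  case; rewrite ?groupX // => c Nc ->.
  by exists k, c.
have [M defQ] : exists M : {group coset_of N}, M \x <[coset N z]> = L / N.
  apply: abelian_cycle_dprod nMz; rewrite ?mem_quotient //.
  by rewrite -morphX // zn1 morph1.
have nNzn : z ^+ (p ^ n) \notin N.
  by apply: contra nMz => Nz; rewrite -morphX //= coset_id.
have ntz : z ^+ (p ^ n) != 1 by apply: contraNneq nNzn => ->.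
have [|K /noL z1] := central_cycle_dprod_lift nsNL Zz _ defQ.
  by apply: cycle_TI_pfactor nNzn => //; apply: order_pfactor.
by rewrite z1 expg1n eqxx in ntz.
Qed.

End CyclicFactors.

(** * Maps between the factors *)

(** A direct product decomposition given by projections and injections, so that the factors need not
    be subgroups of [G]. *)
Record split_prod (gT kT aT : finGroupType)
    (G : {group gT}) (K : {group kT}) (A : {group aT}) := SplitProd {
  projl : subg_of G -> subg_of K;
  projr : subg_of G -> subg_of A;
  injl : subg_of K -> subg_of G;
  injr : subg_of A -> subg_of G;
  projlM : {morph projl : x y / (x * y)%g};
  projrM : {morph projr : x y / (x * y)%g};
  injlM : {morph injl : x y / (x * y)%g};
  injrM : {morph injr : x y / (x * y)%g};
  injlK : cancel injl projl;
  injrK : cancel injr projr;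
  projl_injr : forall a, projl (injr a) = 1%g;
  projr_injl : forall k, projr (injl k) = 1%g;
  split_prodE : forall x, x = (injl (projl x) * injr (projr x))%g }.

Lemma split_prod_comm (gT kT aT : finGroupType) (G : {group gT})
    (K : {group kT}) (A : {group aT}) (s : split_prod G K A) a k :
  (injr s a * injl s k = injl s k * injr s a)%g.
Proof.
rewrite [LHS](split_prodE s) projlM projrM injlK injrK projl_injr projr_injl.
by rewrite mul1g mulg1.
Qed.

Lemma dprod_split (gT : finGroupType) (G K A : {group gT}) :
  (K \x A)%g = G -> inhabited (split_prod G K A).
Proof.
case/dprodP=> _ defG cKA tiKA.
have sKG : K \subset G by rewrite -defG mulG_subl.
have sAG : A \subset G by rewrite -defG mulG_subr.
have cplA : A \in ([complements to K in G])%g by apply/complP.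
have nsKG : (K <| G)%g.
  by rewrite /normal sKG -defG mulG_subG normG cents_norm.
pose pl (x : subg_of G) : subg_of K := subg K (divgr K A (sgval x)).
pose pr (x : subg_of G) : subg_of A := subg A (remgr K A (sgval x)).
pose il (x : subg_of K) : subg_of G := subg G (sgval x).
pose ir (x : subg_of A) : subg_of G := subg G (sgval x).
have plK x : sgval (pl x) = divgr K A (sgval x).
  by rewrite subgK // mem_divgr // defG subgP.
have prK x : sgval (pr x) = remgr K A (sgval x).
  by rewrite subgK // mem_remgr // defG subgP.
have ilK x : sgval (il x) = sgval x by rewrite subgK // (subsetP sKG) ?subgP.
have irK x : sgval (ir x) = sgval x by rewrite subgK // (subsetP sAG) ?subgP.
split; apply: (SplitProd (projl := pl) (projr := pr) (injl := il) (injr := ir)).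
- move=> x y; apply: val_inj; rewrite /= !plK /=.
  by apply: (divgrM cplA); rewrite ?subgP.
- move=> x y; apply: val_inj; rewrite /= !prK /=.
  by apply: (remgrM cplA); rewrite ?subgP.
- by move=> x y; apply: val_inj; rewrite /= !ilK.
- by move=> x y; apply: val_inj; rewrite /= !irK.
- by move=> x; apply: val_inj; rewrite /= plK ilK divgr_id ?subgP.
- by move=> x; apply: val_inj; rewrite /= prK irK remgr_id ?subgP.
- move=> x; apply: val_inj; rewrite /= plK irK -[sgval x]mul1g.
  by rewrite divgrMid ?subgP ?group1.
- move=> x; apply: val_inj; rewrite /= prK ilK -[sgval x]mulg1.
  by rewrite remgrMid ?subgP ?group1.
by move=> x; apply: val_inj; rewrite /= ilK irK plK prK -divgr_eq.
Qed.

Lemma galg_form_map (F : fieldType) (gT hT : finGroupType) (G : {group gT})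
    (H : {group hT}) (phi : subg_of G -> subg_of H)
    (f : {lrmorphism group_algebra F G -> group_algebra F H})
    (lam : subg_of H -> F) u :
    (forall x, f (galg_of F x) = galg_of F (phi x)) ->
  galg_form lam (f u) = galg_form (lam \o phi) u.
Proof.
move=> fE; rewrite {1}[u]galg_sum !linear_sum galg_formE.
by apply: eq_bigr => x _; rewrite !linearZ /= fE galg_form_of.
Qed.

Lemma galg_abelian_central (F : fieldType) (gT : finGroupType) (A : {group gT})
    (u : group_algebra F A) : abelian A -> galg_central u.
Proof.
move=> cAA; apply/galg_centralP=> x y; congr (u _).
rewrite conjgE; apply: val_inj => /=.
by rewrite (centsP cAA (sgval x)) ?subgP // mulKg.
Qed.

(** Since [th (x * y)] equals [th (y * x)] and is invertible, [th] sends commutators to 1. *)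
Lemma der1_in_ker (T : finGroupType) (G : {group T}) (R : nzRingType)
    (th : T -> R) :
    th 1%g = 1 -> (forall x y, th (x * y)%g = th x * th y) ->
    (forall x y, th x * th y = th y * th x) ->
  {in (G^`(1))%g, forall c, th c = 1}.
Proof.
move=> th1 thM thC c; pose K := [set x | th x == 1].
have gK : group_set K.
  apply/group_setP; split=> [|x y]; rewrite !inE ?th1 // thM.
  by move=> /eqP-> /eqP->; rewrite mulr1.
suff /subsetP sK : (G^`(1) \subset Group gK)%g by move/sK; rewrite inE => /eqP.
rewrite derg1 gen_subG; apply/subsetP=> _ /imset2P[x y _ _ ->].
have thxy : th (y * x)%g * th [~ x, y]%g = th (y * x)%g.
  by rewrite -thM -commgC !thM thC.
by rewrite inE -[th _]mul1r -th1 -(mulVg (y * x)%g) thM -mulrA thxy.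
Qed.

Lemma noncyclic_factor_subg (gT : finGroupType) (G : {group gT}) :
    (forall (M : {group gT}) x, M \x <[x]> = G -> x = 1)%g ->
  forall (M : {group subg_of G}) x, (M \x <[x]> = [set: subg_of G] -> x = 1)%g.
Proof.
move=> noG M x /(injm_dprod (subsetT _) (injm_sgval G)).
rewrite im_sgval morphim_cycle ?inE //= => /noG x1.
exact: val_inj.
Qed.

(** * The two surjections between algebras of factors *)

Section Main.
Variables (F : fieldType) (p : nat).
Variables (gT kT aT hT lT bT : finGroupType).
Variables (G : {group gT}) (K : {group kT}) (A : {group aT}).
Variables (H : {group hT}) (L : {group lT}) (B : {group bT}).
Hypotheses (pF : p \in [pchar F]) (pG : (p.-group G)%g) (pH : (p.-group H)%g).
Hypotheses (pA : (p.-group A)%g) (pL : (p.-group L)%g).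
Variables (sG : split_prod G K A) (sH : split_prod H L B).
Hypothesis cAA : abelian A.
Hypothesis noL : forall (M : {group lT}) x, (M \x <[x]> = L -> x = 1)%g.
Variables (f : {lrmorphism group_algebra F G -> group_algebra F H}).
Variables (g : {lrmorphism group_algebra F H -> group_algebra F G}).
Hypotheses (fK : cancel f g) (gK : cancel g f).

Variables (piA : {lrmorphism group_algebra F G -> group_algebra F A}).
Variables (piL : {lrmorphism group_algebra F H -> group_algebra F L}).
Variables (iA : {lrmorphism group_algebra F A -> group_algebra F G}).
Variables (iK : {lrmorphism group_algebra F K -> group_algebra F G}).
Variables (iL : {lrmorphism group_algebra F L -> group_algebra F H}).
Variables (iB : {lrmorphism group_algebra F B -> group_algebra F H}).
Hypothesis piA_of : forall x, piA (galg_of F x) = galg_of F (projr sG x).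
Hypothesis piL_of : forall x, piL (galg_of F x) = galg_of F (projl sH x).
Hypothesis iA_of : forall x, iA (galg_of F x) = galg_of F (injr sG x).
Hypothesis iK_of : forall x, iK (galg_of F x) = galg_of F (injl sG x).
Hypothesis iL_of : forall x, iL (galg_of F x) = galg_of F (injl sH x).
Hypothesis iB_of : forall x, iB (galg_of F x) = galg_of F (injr sH x).

Lemma piLK u : piL (iL u) = u.
Proof.
rewrite [RHS]galg_sum {1}[u]galg_sum !linear_sum; apply: eq_bigr => x _.
by rewrite !linearZ /= iL_of piL_of injlK.
Qed.

Lemma central_factor_surjective :
  limg (linfun (piA \o g \o iB)) = fullv.
Proof.
apply: (galg_surjective (q := piA \o g \o iB) pF pA) => lam lamD lam0.
pose q : {lrmorphism _ -> _} := piA \o g.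
pose mu h := galg_form lam (q (galg_of F h)).
have muD : additive_char mu by apply: (additive_char_pullback pF pH).
pose nu := mu \o injl sH.
have nuD : additive_char nu by move=> x y; rewrite /nu /= injlM muD.
have muir b : mu (injr sH b) = 0 by rewrite -(lam0 (galg_of F b)) /= iB_of.
(* Being trivial on [B], [mu] factors through the projection to [L]. *)
have muE u : galg_form lam (q u) = galg_form nu (piL u).
  transitivity (galg_form mu u); first exact: galg_form_pullback.
  rewrite (galg_form_map nu u piL_of) !galg_formE.
  apply: eq_bigr => h _; congr (_ * _).
  rewrite -/(mu h) [in LHS](split_prodE sH h) muD.
  by rewrite [X in _ + X]muir addr0.
suff lamp n a : (a ^+ (p ^ n) = 1)%g -> lam a = 0.
  by move=> a; have [n /lamp] := pgroup_subg_expg pA a.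
elim: n a => [|n IHn] a an1.
  by rewrite -[a]expg1 an1 additive_char1.
pose w := f (iA (galg_of F a)).
have lamE : lam a = galg_form nu (piL w - 1).
  rewrite linearB /= (galg_form1 nuD) subr0 -muE /= fK.
  by rewrite iA_of piA_of injrK galg_form_of.
rewrite lamE; apply: (galg_form_nilpotent_central pF pL (n := n.+1)) => //.
(* As [A] is abelian, [a] is central in [G], so [w] is central. Its image under [piL] stays central
   because [piL] has the section [iL]. *)
- move=> v; rewrite mulrBr mulrBl mul1r mulr1; congr (_ - _).
  have cw u : u * w = w * u.
    rewrite -[u]gK -!rmorphM; congr (f _); move: (g u); apply/galg_mulC_of => x.
    rewrite iA_of -!galg_ofM; congr galg_of; rewrite (split_prodE sG x).
    rewrite mulgA split_prod_comm -!mulgA -!injrM; congr (_ * injr _ _)%g.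
    by apply: val_inj; rewrite /= (centsP cAA) ?subgP.
  by rewrite -[v]piLK -!rmorphM cw.
- rewrite exprBpn_comm ?galg_pchar //; last exact: commr1.
  by rewrite expr1n -!rmorphXn -galg_ofX an1 galg_of1 !rmorph1 subrr.
move=> z Zz zn1.
have p_pr := pcharf_prime pF.
have [k [c [_ dc zE]]] := central_exp_in_Mho_der (pgroup_subg pL) p_pr
  (noncyclic_factor_subg noL) Zz zn1.
pose th x := q (iL (galg_of F x)).
have thM x y : th (x * y)%g = th x * th y by rewrite /th galg_ofM !rmorphM.
have th1 : th 1%g = 1 by rewrite /th galg_of1 !rmorph1.
have thC x y : th x * th y = th y * th x.
  exact: (galg_abelian_central (th y) cAA (th x)).
have thX x m : th (x ^+ m)%g = th x ^+ m.
  by elim: m => [|m IHm]; rewrite ?th1 // expgS exprS thM IHm.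
have thc := der1_in_ker th1 thM thC dc.
have nuE x : nu x = galg_form lam (th x) by rewrite /th iL_of.
have nukp : nu (k ^+ p)%g = 0.
  by rewrite additive_charX // mulrn_pchar.
(* Since [nu] kills [k ^+ p], [nu z] is the form of [lam] at [th z - th (k ^+ p)]. Its [p ^ n]-th
   power is zero because [th c = 1], so the induction hypothesis at [n] suffices. *)
rewrite -[nu z]subr0 -[X in _ - X]nukp !nuE -linearB /=.
apply: (galg_form_nilpotent_central pF pA (n := n)) => //.
- exact: galg_abelian_central.
- rewrite exprBpn_comm ?galg_pchar //.
  by rewrite -!thX -expgM -expnS zE thM thc mul1r subrr.
by move=> y _ /IHn.
Qed.

(** A form [lam] vanishing on the image of [K] becomes, pulled back to [G], a form that depends on
    the [A] component alone. By surjectivity each [l] has the same [A] component as some element of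
    the algebra of [B]; that element projects to a scalar in the algebra of [L], where [lam]
    vanishes. *)
Lemma complement_surjective :
  limg (linfun (piA \o g \o iB)) = fullv ->
  limg (linfun (piL \o f \o iK)) = fullv.
Proof.
move=> surj.
apply: (galg_surjective (q := piL \o f \o iK) pF pL) => lam lamD lam0 l.
pose q : {lrmorphism _ -> _} := piL \o f.
pose mu x := galg_form lam (q (galg_of F x)).
have muD : additive_char mu by apply: (additive_char_pullback pF pG).
pose nu := mu \o injr sG.
have muil k : mu (injl sG k) = 0 by rewrite -(lam0 (galg_of F k)) /= iK_of.
have muE u : galg_form lam (q u) = galg_form nu (piA u).
  transitivity (galg_form mu u); first exact: galg_form_pullback.
  rewrite (galg_form_map nu u piA_of) !galg_formE.
  apply: eq_bigr => x _; congr (_ * _).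
  rewrite -/(mu x) [in LHS](split_prodE sG x) muD.
  by rewrite [X in X + _]muil add0r.
have /memv_imgP[b _] :
    piA (g (iL (galg_of F l))) \in limg (linfun (piA \o g \o iB)).
  by rewrite surj memvf.
rewrite lfunE /= => bE.
have -> : lam l = galg_form lam (q (g (iB b))).
  by rewrite muE -bE -muE /= gK iL_of piL_of injlK galg_form_of.
rewrite /= gK (galg_form_map _ _ piL_of) (galg_form_map _ _ iB_of) galg_formE.
by rewrite big1 // => c _; rewrite /= projl_injr additive_char1 ?mulr0.
Qed.

End Main.

(** * Algebra isomorphisms and the conclusion *)

Lemma alg_isomorphic_inv (R : nzRingType) (A B : algType R) :
  alg_isomorphic A B ->
  exists (f : {lrmorphism A -> B}) (g : {lrmorphism B -> A}),
    cancel f g /\ cancel g f.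
Proof.
case=> f [g fK gK]; exists f.
pose gL := GRing.isLinear.Build R B A *:%R g (can2_linear fK gK).
pose gM := GRing.isMonoidMorphism.Build B A g (can2_monoid_morphism fK gK).
pose g' : {lrmorphism B -> A} := HB.pack g gL gM.
by exists g'.
Qed.

Lemma alg_isomorphic_trans (R : nzRingType) (A B C : algType R) :
  alg_isomorphic A B -> alg_isomorphic B C -> alg_isomorphic A C.
Proof.
by case=> f bf [g bg]; exists (g \o f : {lrmorphism _ -> _}); apply: bij_comp.
Qed.

Lemma galg_isog (F : fieldType) (gT hT : finGroupType) (G : {group gT})
    (H : {group hT}) :
  G \isog H -> alg_isomorphic (group_algebra F G) (group_algebra F H).
Proof.
case/isogP=> f injf fG.
pose phi (x : subg_of G) : subg_of H := subg H (f (sgval x)).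
have phiE x : sgval (phi x) = f (sgval x).
  by rewrite subgK // -fG mem_morphim ?subgP.
have phiM : {morph phi : x y / (x * y)%g}.
  by move=> x y; apply: val_inj; rewrite /= !phiE /= morphM ?subgP.
have [psi phiK psiK] : bijective phi.
  apply: inj_card_bij => [x y|].
    move/(congr1 val); rewrite /= !phiE => /(injmP injf); rewrite !subgP.
    by move=> xy; apply: val_inj; apply: xy.
  by rewrite -!cardsT -!(card_isog (isog_subg _)) -fG card_injm.
have fE := galg_map_of F phiM; exists (galg_map F phiM).
move: (galg_map F phiM) fE => q qE.
have [h hE] : exists h : {linear group_algebra F H -> group_algebra F G},
    forall y, h (galg_of F y) = galg_of F (psi y).
  exists (galg_lift (fun y => galg_of F (psi y))) => y; exact: galg_lift_of.
exists h => u; rewrite [RHS]galg_sum {1}[u]galg_sum !linear_sum;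
  by apply: eq_bigr => x _; rewrite !linearZ /= !(qE, hE) ?phiK ?psiK ?qE ?psiK.
Qed.

(** The surjection [g] bounds the dimension of [U] by that of [V], so rank-nullity leaves [f] no
    kernel. *)
Lemma limg_full_bijective (F : fieldType) (U V : vectType F)
    (f : {linear U -> V}) (g : {linear V -> U}) :
  limg (linfun f) = fullv -> limg (linfun g) = fullv -> bijective f.
Proof.
move=> surjf surjg.
have dimUV : (\dim {:U} <= \dim {:V})%N.
  by rewrite -(limg_ker_dim (linfun g) fullv) surjg leq_addl.
have kf0 : lker (linfun f) == 0%VS.
  rewrite -dimv_eq0 -leqn0 -(leq_add2r (\dim {:V})).
  by rewrite -{1}surjf -[X in (\dim X + _)%N]capfv limg_ker_dim add0n.
exists (linfun f)^-1%VF => u; first by rewrite -[f u]lfunE lker0_lfunK.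
by rewrite -[f _]lfunE limg_lfunVK // surjf memvf.
Qed.

(** A cyclic factor [<[x]>] of [K] could be merged with [A] into an abelian direct factor of order
    [#[x]] times that of [A]; maximality forces [#[x] = 1]. *)
Lemma complement_noncyclic_factor (gT : finGroupType) (G A K : {group gT}) :
    max_abelian_direct_factor A G -> (K \x A)%g = G ->
  forall (M : {group gT}) x, (M \x <[x]> = K -> x = 1)%g.
Proof.
case=> [[cAA _] maxA] defG M x defK.
have := defG; rewrite -defK -dprodA => /dprodP[[_ B _ defB] _ _ _].
have [_ defB' cAx _] := dprodP defB.
have /maxA : abelian_direct_factor B G.
  split; last by exists M; rewrite -defB dprodA defK defG.
  by rewrite -defB' abelianM cycle_abelian cAA.
rewrite -(dprod_card defB) -[X in (_ <= X)%N]mul1n leq_pmul2r ?cardG_gt0 //.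
by rewrite -[#|_|]/(#[x]%g) leqNgt order_gt1 negbK => /eqP.
Qed.

Lemma galg_complement_surjection (F : fieldType) (p : nat)
    (gT hT : finGroupType) (G K A : {group gT}) (H L B : {group hT})
    (f : {lrmorphism group_algebra F G -> group_algebra F H})
    (g : {lrmorphism group_algebra F H -> group_algebra F G}) :
    p \in [pchar F] -> (p.-group G)%g -> (p.-group H)%g ->
    (K \x A)%g = G -> (L \x B)%g = H -> abelian A ->
    (forall (M : {group hT}) x, (M \x <[x]> = L -> x = 1)%g) ->
    cancel f g -> cancel g f ->
  exists r : {lrmorphism group_algebra F K -> group_algebra F L},
    limg (linfun r) = fullv.
Proof.
move=> pF pG pH defG defH cAA noL fK gK.
have [sG] := dprod_split defG; have [sH] := dprod_split defH.
have pA : (p.-group A)%g.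
  by apply: pgroupS pG; case/dprodP: defG => _ <- _ _; apply: mulG_subr.
have pL : (p.-group L)%g.
  by apply: pgroupS pH; case/dprodP: defH => _ <- _ _; apply: mulG_subl.
have piA_of := galg_map_of F (@projrM _ _ _ _ _ _ sG).
have piL_of := galg_map_of F (@projlM _ _ _ _ _ _ sH).
have iA_of := galg_map_of F (@injrM _ _ _ _ _ _ sG).
have iK_of := galg_map_of F (@injlM _ _ _ _ _ _ sG).
have iL_of := galg_map_of F (@injlM _ _ _ _ _ _ sH).
have iB_of := galg_map_of F (@injrM _ _ _ _ _ _ sH).
exists (galg_map F (@projlM _ _ _ _ _ _ sH) \o f \o
        galg_map F (@injlM _ _ _ _ _ _ sG) : {lrmorphism _ -> _}).
apply: (complement_surjective pF pG pL gK piA_of piL_of iK_of iL_of iB_of).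
exact: (central_factor_surjective pF pH pA pL cAA noL fK gK
  piA_of piL_of iA_of iL_of iB_of).
Qed.

Theorem theorem3 (F : fieldType) (p : nat) (hp : p \in [pchar F]%R)
    (gT hT : finGroupType) (G GA : {group gT}) (H HA : {group hT})
    (pG : (p.-group G)%g) (pH : (p.-group H)%g)
    (hGA : max_abelian_direct_factor GA G)
    (hHA : max_abelian_direct_factor HA H)
    (hFG : alg_isomorphic (group_algebra F G)
                          (group_algebra F H)) :
  alg_isomorphic (group_algebra F (G / GA))
                 (group_algebra F (H / HA)).
Proof.
have [[cGA [K defG]] _] := hGA; have [[cHA [L defH]] _] := hHA.
have [f [g [fK gK]]] := alg_isomorphic_inv hFG.
have [r surjr] := galg_complement_surjection hp pG pH defG defH cGA
  (complement_noncyclic_factor hHA defH) fK gK.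
have [r' surjr'] := galg_complement_surjection hp pH pG defH defG cHA
  (complement_noncyclic_factor hGA defG) gK fK.
(* The surjections concern the complements [K] and [L], which are isomorphic to the quotients by the
   abelian factors. *)
have isoK : (G / GA)%G \isog K.
  by rewrite isog_sym; apply: sdprod_isog; apply: dprodWsdC.
have isoL : L \isog (H / HA)%G by apply: sdprod_isog; apply: dprodWsdC.
apply: alg_isomorphic_trans (galg_isog F isoK) _.
apply: alg_isomorphic_trans (galg_isog F isoL).
by exists r; apply: limg_full_bijective surjr surjr'.
Qed.
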